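(* For any integer $k\geq 1$, every graph $G$ of cliquewidth at most $k$ admits a dominated partition $\mathcal{P}$ such that the quotient $G/\mathcal{P}$ has treewidth at most $k-1$.
   Context: Graphs are finite and simple. $N_G[v]$ is the closed neighbourhood of $v$ (the vertex $v$ together with its neighbours). A set $S\subseteq V(G)$ is dominated in $G$ if $S\subseteq N_G[v]$ for some $v\in V(G)$. A partition $\mathcal{P}$ of $G$ is a collection of nonempty pairwise disjoint subsets (parts) of $V(G)$ with union $V(G)$ (parts need not induce connected subgraphs); it is dominated if every part is dominated in $G$. The quotient $G/\mathcal{P}$ has vertex set $\mathcal{P}$, with two distinct parts adjacent iff some vertex of one is adjacent in $G$ to some vertex of the other. Cliquewidth: with colourings $c:V(G)\to\{1,\dots,k\}$ (colour $i$ used if $c^{-1}(i)\ne\emptyset$), $(G,c)$ is a cliquewidth-$k$ pair if $|V(G)|\leq 1$ or: (OP1) $G$ is the disjoint union of nonempty $G_1,G_2$ with $(G_1,c|_{V(G_1)}),(G_2,c|_{V(G_2)})$ cliquewidth-$k$ pairs; or (OP2) there are a colouring $c'$ and distinct $i,j$, both used by $c'$, with $(G,c')$ a cliquewidth-$k$ pair and $c$ obtained from $c'$ by recolouring every vertex of colour $i$ to $j$; or (OP3) there are a proper spanning subgraph $G'$ of $G$ and distinct $i,j$ with $(G',c)$ a cliquewidth-$k$ pair and $G$ obtained from $G'$ by adding all edges between vertices coloured $i$ and vertices coloured $j$. The cliquewidth of $G$ is the least $k$ such that $(G,c)$ is a cliquewidth-$k$ pair for some colouring $c$ with colours $\{1,\dots,k\}$.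 Treewidth is the usual minimum width (maximum bag size minus 1) of a tree-decomposition. *)

(* Defs.v *)
From mathcomp Require Import all_boot all_order all_algebra.
From mathcomp Require Import boolp.
Set Implicit Arguments.
Unset Strict Implicit.
Unset Printing Implicit Defensive.

(** Finite simple graphs with vertex set [T]; the graph with no vertex is
    allowed. *)
Record sgraph (T : finType) := SGraph {
  adj :> rel T;
  adj_sym : symmetric adj;
  adj_irr : irreflexive adj }.

Section Graphs.
Variables (T : finType) (G : sgraph T).

Definition closed_nbhd (v : T) : {set T} := [set u | (u == v) || G v u].

Definition dominated (S : {set T}) : bool :=
  [exists v, S \subset closed_nbhd v].

Definition dominated_partition (P : {set {set T}}) : bool :=
  partition P [set: T] && [forall A in P, dominated A].

Section Induced.
Variable A : {set T}.
Definition induced_rel : rel {x : T | x \in A} := fun x y => G (val x) (val y).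
Fact induced_sym : symmetric induced_rel.
Proof. by move=> x y; apply: adj_sym. Qed.
Fact induced_irr : irreflexive induced_rel.
Proof. by move=> x; apply: adj_irr. Qed.
Definition induced : sgraph {x : T | x \in A} := SGraph induced_sym induced_irr.
End Induced.

Section Quotient.
Variable P : {set {set T}}.
Definition quotient_rel : rel {A : {set T} | A \in P} := fun A B =>
  (A != B) && [exists x in val A, exists y in val B, G x y].
Fact quotient_sym : symmetric quotient_rel.
Proof.
have H A B : quotient_rel A B -> quotient_rel B A.
  case/andP=> nAB /existsP[x /andP[xA /existsP[y /andP[yB xy]]]].
  rewrite /quotient_rel eq_sym nAB /=; apply/existsP; exists y.
  by rewrite yB; apply/existsP; exists x; rewrite xA adj_sym.
by move=> A B; apply/idP/idP; apply: H.
Qed.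
Fact quotient_irr : irreflexive quotient_rel.
Proof. by move=> A; rewrite /quotient_rel eqxx. Qed.
Definition quotient : sgraph {A : {set T} | A \in P} :=
  SGraph quotient_sym quotient_irr.
End Quotient.

Definition connected : Prop :=
  0 < #|T| /\ forall x y : T, connect G x y.

(** A [ucycle] of size 2 is just an edge traversed back and forth. *)
Definition acyclic : Prop := forall s : seq T, 2 < size s -> ~ ucycle G s.

Definition tree : Prop := connected /\ acyclic.

End Graphs.

Definition tree_decomposition (T : finType) (G : sgraph T)
    (I : finType) (F : sgraph I) (B : I -> {set T}) : Prop :=
  [/\ tree F,
      forall v : T, exists i, v \in B i,
      forall u v : T, G u v -> exists i, (u \in B i) && (v \in B i)
    & forall v : T, connected (induced F [set i | v \in B i])].

Definition has_tree_decomposition_max_bag (T : finType) (G : sgraph T)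
    (n : nat) : Prop :=
  exists (I : finType) (F : sgraph I) (B : I -> {set T}),
    tree_decomposition G F B /\ \max_(i : I) #|B i| = n.

Fact tree_decomposition_exists (T : finType) (G : sgraph T) :
  exists n, `[< has_tree_decomposition_max_bag G n >].
Proof.
exists (\max_(i : unit) #|[set: T]|); apply/asboolP.
have s0 : symmetric (fun _ _ : unit => false) by [].
have i0 : irreflexive (fun _ : unit => xpred0 : pred unit) by [].
exists unit, (SGraph s0 i0), (fun _ => [set: T]); split=> //; split.
- split; first by split; [rewrite card_unit | case=> [[]]; apply: connect0].
  by move=> [|[] [|[] [|]]].
- by move=> v; exists tt; rewrite inE.
- by move=> u v _; exists tt; rewrite !inE.
- move=> v; split.
    by rewrite card_sig; apply/card_gt0P; exists tt; rewrite !inE.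
  move=> x y; suff -> : x = y by exact: connect0.
  by apply: val_inj; case: (val x) (val y) => [[]].
Qed.

(** Valued in [int], since the graph with no vertex has treewidth [-1]. *)
Definition treewidth (T : finType) (G : sgraph T) : int :=
  ((ex_minn (tree_decomposition_exists G))%:Z - 1)%R.

(** [cw_pair G c]: the pair (G, c) is a cliquewidth-[k] pair; the colours are
    the elements of ['I_k], and colour [i] is used by [c] iff
    [i \in codom c]. *)
Inductive cw_pair (k : nat) :
    forall T : finType, sgraph T -> (T -> 'I_k) -> Prop :=
| cw_small (T : finType) (G : sgraph T) (c : T -> 'I_k) :
    #|T| <= 1 -> cw_pair G c
| cw_union (T : finType) (G : sgraph T) (c : T -> 'I_k) (A : {set T}) :
    A != set0 -> ~: A != set0 ->
    (forall x y, x \in A -> y \in ~: A -> ~~ G x y) ->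
    cw_pair (induced G A) (fun x => c (val x)) ->
    cw_pair (induced G (~: A)) (fun x => c (val x)) ->
    cw_pair G c
| cw_recolour (T : finType) (G : sgraph T) (c c' : T -> 'I_k) (i j : 'I_k) :
    i != j -> i \in codom c' -> j \in codom c' ->
    cw_pair G c' ->
    (forall x, c x = if c' x == i then j else c' x) ->
    cw_pair G c
| cw_join (T : finType) (G G' : sgraph T) (c : T -> 'I_k) (i j : 'I_k) :
    i != j ->
    (exists x y, G x y && ~~ G' x y) ->
    (forall x y, G x y =
       [|| G' x y, (c x == i) && (c y == j) | (c x == j) && (c y == i)]) ->
    cw_pair G' c ->
    cw_pair G c.

Definition has_cw_pair (T : finType) (G : sgraph T) (k : nat) : Prop :=
  exists c : T -> 'I_k, cw_pair G c.

Lemma cw_pair_edgeless (k : nat) (T : finType) (G : sgraph T) (c : T -> 'I_k) :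
  (forall x y, ~~ G x y) -> cw_pair G c.
Proof.
move: {2}#|T| (leqnn #|T|) => n.
elim: n T G c => [|n IH] T G c leTn noG; first exact/cw_small/(leq_trans leTn).
have [|T_gt1] := leqP #|T| 1; first exact: cw_small.
have /card_gt0P[x _] : 0 < #|T| by apply: ltn_trans T_gt1.
have cardx : #|~: [set x]| = #|T|.-1 by rewrite cardsC1.
apply: (@cw_union _ _ _ _ [set x]) => //.
- by apply/set0Pn; exists x; rewrite inE.
- by rewrite -card_gt0 cardx; case: #|T| T_gt1 => [|[]].
- by apply: cw_small; rewrite card_sig cards1.
- by apply: IH => [|u v]; [rewrite card_sig cardx; case: #|T| leTn | apply: noG].
Qed.

Lemma cw_pair_inj (k : nat) (T : finType) (G : sgraph T) (c : T -> 'I_k) :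
  injective c -> cw_pair G c.
Proof.
move=> c_inj; move: {2}#|_| (leqnn #|[set p : T * T | G p.1 p.2]|) => n.
elim: n G => [|n IH] G leGn.
  apply: cw_pair_edgeless => x y; apply/negP => xy.
  move: leGn; rewrite leqn0 cards_eq0 => /eqP/setP/(_ (x, y)).
  by rewrite !inE /= xy.
have [/existsP[x /existsP[y xy]]|noG] := boolP [exists x, exists y, G x y]; last first.
  apply: cw_pair_edgeless => x y; apply: contra noG => xy.
  by apply/existsP; exists x; apply/existsP; exists y.
have nxy : x != y by apply: contraTneq xy => ->; rewrite adj_irr.
pose e u v := (u == x) && (v == y) || (u == y) && (v == x).
have eS u v : e u v = e v u by rewrite /e orbC; congr (_ || _); rewrite andbC.
pose r : rel T := fun u v => G u v && ~~ e u v.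
have rS : symmetric r by move=> u v; rewrite /r eS adj_sym.
have rI : irreflexive r by move=> u; rewrite /r adj_irr.
apply: (@cw_join _ _ _ (SGraph rS rI) c (c x) (c y)).
- by rewrite (inj_eq c_inj).
- by exists x, y; rewrite xy /= /r /e !eqxx /= andbF.
- move=> u v /=; rewrite !(inj_eq c_inj) -/(e u v) /r.
  case euv: (e u v); last by rewrite andbT orbF.
  rewrite andbF /=; case/orP: euv => /andP[/eqP-> /eqP->] //.
  by rewrite adj_sym.
- apply: IH; rewrite -ltnS; apply: leq_trans leGn; apply: proper_card.
  apply/properP; split.
    by apply/subsetP=> p; rewrite !inE => /andP[].
  by exists (x, y); rewrite !inE //= /r /e !eqxx /= andbF.
Qed.

Fact cw_pair_exists (T : finType) (G : sgraph T) :
  exists k, `[< has_cw_pair G k >].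
Proof.
by exists #|T|; apply/asboolP; exists enum_rank; apply/cw_pair_inj/enum_rank_inj.
Qed.

Definition cliquewidth (T : finType) (G : sgraph T) : nat :=
  ex_minn (cw_pair_exists G).

(* Main.v *)
Require Import Defs.
From mathcomp Require Import all_boot all_order all_algebra.
From mathcomp Require Import boolp.
Set Implicit Arguments.
Unset Strict Implicit.
Unset Printing Implicit Defensive.

(** Call a colour class of an intermediate pair of the cliquewidth construction
    active if it is contained in a class used by a later join; this join gives
    its vertices a common neighbour, so it is dominated.  The active classes form
    a laminar family; the parts are its maximal members, together with a
    singleton for each vertex that is never active.  The construction tree
    carries a tree-decomposition of the quotient: the bag of a node consists of
    the parts containing an active class of that node, at most one per colour.
    A part occurs in the nodes below the one where it is maximal that contain
    one of its vertices, which is a subtree, and an edge created by a join lies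
    in the bag just below this join. *)

(** * Rooted trees and connectivity by descent *)

Record rooted_tree := RootedTree {
  node :> finType;
  root : node;
  parent : node -> node;
  depth : node -> nat;
  depth_parent : forall n, n != root -> depth (parent n) < depth n }.

Lemma connected_descent (V : finType) (G : sgraph V) (t : V) (d : V -> nat) :
  (forall v, v != t -> exists2 w, G v w & d w < d v) -> connected G.
Proof.
move=> descent; split; first by apply/card_gt0P; exists t.
have to_t v : connect G v t.
  have [n] := ubnP (d v); elim: n v => // n IH v dv.
  have [->|/descent[w vw dw]] := eqVneq v t; first exact: connect0.
  apply: connect_trans (connect1 vw) (IH _ _).
  by rewrite ltnS in dv; apply: leq_trans dw dv.
move=> x y; apply: connect_trans (to_t x) _.
by rewrite (sym_connect_sym (adj_sym G)).
Qed.

Section TreeOfRootedTree.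
Variable R : rooted_tree.

(** The value of [parent] at the root is arbitrary, so edges are drawn only from the other nodes. *)
Definition parent_rel : rel R := fun m n =>
  (m != root R) && (parent m == n) || (n != root R) && (parent n == m).

Lemma parent_rel_sym : symmetric parent_rel.
Proof. by move=> m n; rewrite /parent_rel orbC. Qed.

Lemma parent_rel_irr : irreflexive parent_rel.
Proof.
move=> n; rewrite /parent_rel orbb; apply/negP => /andP[/depth_parent + /eqP e].
by rewrite e ltnn.
Qed.

Definition parent_graph : sgraph R := SGraph parent_rel_sym parent_rel_irr.

Lemma parent_relW (m n : R) : depth n <= depth m -> parent_rel m n ->
  parent m = n.
Proof.
move=> le_nm /orP[/andP[_ /eqP] //|/andP[/depth_parent + /eqP e]].
by rewrite e ltnNge le_nm.
Qed.

Lemma parent_graph_tree : tree parent_graph.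
Proof.
split.
  apply: (@connected_descent _ _ (root R) (@depth R)) => n nr.
  by exists (parent n); rewrite ?depth_parent //= /parent_rel nr eqxx.
(* In a cycle, both neighbours of a deepest node would be its parent. *)
move=> s s_gt2 /andP[cyc us].
have [x0 x0s] : exists x, x \in s.
  by case: s s_gt2 {cyc us} => // x s; exists x; rewrite mem_head.
case: (@arg_maxnP _ x0 (mem s) (@depth R) x0s) => n ns max_n.
have [i s' def_s] := rot_to ns.
move: cyc us s_gt2; rewrite -(rot_cycle i) -(rot_uniq i) -(size_rot i) def_s.
have {}max_n m : m \in s' -> depth m <= depth n.
  by move=> ms'; apply: max_n; rewrite /= -(mem_rot i) def_s inE ms' orbT.
case: s' max_n {def_s} => [|a s'] max_n //.
case/lastP: s' max_n => [|s' z] max_n //.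
rewrite /= rcons_path last_rcons => /andP[na /andP[_ zn]].
rewrite parent_rel_sym in zn.
have za : a = z.
  rewrite -(parent_relW (max_n _ _) na) ?mem_head //.
  by rewrite (parent_relW (max_n _ _) zn) // inE mem_rcons mem_head orbT.
by rewrite mem_rcons za mem_head !andbF.
Qed.

Lemma connected_below (S : {set R}) (t : R) :
  t \in S -> (forall n, n \in S -> n != t -> n != root R /\ parent n \in S) ->
  connected (induced parent_graph S).
Proof.
move=> tS up.
apply: (@connected_descent _ _ (Sub t tS) (fun n => depth (val n))) => n nt.
have [|nr pS] := up (val n) (valP n).
  by apply: contraNneq nt => e; apply/eqP/val_inj.
exists (Sub (parent (val n)) pS); last exact: depth_parent.
by rewrite /= /induced_rel /= /parent_rel nr eqxx.
Qed.

End TreeOfRootedTree.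

(** * Joining two trees under a new root *)

Section NewRoot.
Variables R1 R2 : rooted_tree.

Definition graft_parent (n : option (R1 + R2)) : option (R1 + R2) :=
  match n with
  | None => None
  | Some (inl m) => if m == root R1 then None else Some (inl (parent m))
  | Some (inr m) => if m == root R2 then None else Some (inr (parent m))
  end.

Definition graft_depth (n : option (R1 + R2)) : nat :=
  match n with
  | None => 0
  | Some (inl m) => (depth m).+1
  | Some (inr m) => (depth m).+1
  end.

Lemma graft_depth_parent n : n != None ->
  graft_depth (graft_parent n) < graft_depth n.
Proof.
case: n => [[m|m]|] //= _; case: eqVneq => // /depth_parent.
  by rewrite /= ltnS.
by rewrite /= ltnS.
Qed.

Definition graft : rooted_tree := RootedTree graft_depth_parent.

End NewRoot.

(** The nodes whose bag contains [S] form a subtree with topmost node [t]. *)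
Definition top_node (L : finType) (R : rooted_tree) (B : R -> {set L})
    (S : L) (t : R) : Prop :=
  S \in B t /\
  forall n, S \in B n -> n != t -> n != root R /\ S \in B (parent n).

Section GraftBag.
Variables (L : finType) (R1 R2 : rooted_tree).
Variables (C : {set L}) (B1 : R1 -> {set L}) (B2 : R2 -> {set L}).

Definition graft_bag (n : graft R1 R2) : {set L} :=
  match n with
  | None => C
  | Some (inl m) => B1 m
  | Some (inr m) => B2 m
  end.

(** The old root can hold [S] only if it is [t] itself, so its new parent [None] imposes nothing. *)
Lemma top_node_graftl S t : S \notin C -> (forall m, S \notin B2 m) ->
  top_node B1 S t -> top_node graft_bag S (Some (inl t)).
Proof.
move=> /negP CS B2S [St up]; split=> // -[[m|m]|] //=; last first.
  by move/negP: (B2S m).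
move=> Sm mt; have [|mr pm] := up m Sm; first by apply: contraNneq mt => ->.
by rewrite (negPf mr).
Qed.

Lemma top_node_graftr S t : S \notin C -> (forall m, S \notin B1 m) ->
  top_node B2 S t -> top_node graft_bag S (Some (inr t)).
Proof.
move=> /negP CS B1S [St up]; split=> // -[[m|m]|] //=.
  by move/negP: (B1S m).
move=> Sm mt; have [|mr pm] := up m Sm; first by apply: contraNneq mt => ->.
by rewrite (negPf mr).
Qed.

(** On each side where [S] occurs, its subtree reaches the old root, now a child of [None]; the new
    root links the two subtrees. *)
Lemma top_node_graft_root S : S \in C ->
  (forall m, S \in B1 m -> top_node B1 S (root R1)) ->
  (forall m, S \in B2 m -> top_node B2 S (root R2)) ->
  top_node graft_bag S None.
Proof.
move=> CS top1 top2; split=> // -[[m|m]|] //= Sm _.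
  have [_ up] := top1 m Sm; split=> //.
  by case: eqVneq => //= mr; have [] := up m Sm mr.
have [_ up] := top2 m Sm; split=> //.
by case: eqVneq => //= mr; have [] := up m Sm mr.
Qed.

End GraftBag.

(** * The induction invariant, small graphs and recolouring *)

(** [f i] is the part that the vertices of colour [i] belong to, with
    [f i = set0] encoding that colour [i] is not active; parts are subsets of
    the vertex set [U] of the whole graph, in which [h] embeds [T]. *)
Definition decomposed (k : nat) (T : finType) (G : sgraph T) (c : T -> 'I_k)
    (U : finType) (h : T -> U) (f : 'I_k -> {set U}) : Prop :=
  exists (p : T -> {set U}) (R : rooted_tree) (B : R -> {set {set U}}),
    [/\ forall x, f (c x) != set0 ->
          p x = f (c x) /\ top_node B (p x) (root R),
        forall x, f (c x) = set0 ->
          [/\ h x \in p x, exists t, top_node B (p x) t,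
              forall u, u \in p x ->
                exists y, [/\ u = h y, f (c y) = set0 & p y = p x]
            & exists v, forall y, h y \in p x -> y \in closed_nbhd G v],
        forall n S, S \in B n -> exists x, S = p x,
        forall n, #|B n| <= k
      & forall x y, G x y -> exists n, (p x \in B n) && (p y \in B n)].

(** In particular, vertices of inactive colours avoid every [f i], which keeps the parts created
    inside [T] distinct from those fixed by later operations. *)
Definition compatible (k : nat) (T : finType) (c : T -> 'I_k) (U : finType)
    (h : T -> U) (f : 'I_k -> {set U}) : Prop :=
  forall x i, h x \in f i -> f i = f (c x).

Lemma decomposed_small k (T : finType) (G : sgraph T) (c : T -> 'I_k)
    (U : finType) (h : T -> U) f :
  #|T| <= 1 -> decomposed G c h f.
Proof.
move=> T1.
have depth_unit (n : unit) : n != tt -> 0 < 0 by case: n.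
have eqT (x y : T) : x = y by exact: (fintype_le1P T1).
pose p x := if f (c x) == set0 then [set h x] else f (c x).
exists p, (@RootedTree unit tt id (fun=> 0) depth_unit), (fun=> p @: T).
have top x : top_node (R := RootedTree depth_unit) (fun=> p @: T) (p x) tt.
  by split=> [|[]//]; apply: imset_f.
split.
- by move=> x fx; split; [rewrite /p (negPf fx) | apply: top].
- move=> x fx; have px : p x = [set h x] by rewrite /p fx eqxx.
  split; first by rewrite px set11.
  + by exists tt; apply: top.
  + by move=> u; rewrite px => /set1P->; exists x.
  + by exists x => y _; rewrite (eqT y x) inE eqxx.
- by move=> _ S /imsetP[x _ ->]; exists x.
- move=> _; apply: leq_trans (leq_imset_card _ _) _.
  (* A vertex has a colour in ['I_k], which forces [0 < k]. *)
  have [->|/card_gt0P[x _]] := posnP #|T|; first by [].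
  by apply: leq_trans T1 _; case: (k) (c x) => // -[].
- by move=> x y; rewrite (eqT x y) adj_irr.
Qed.

(** Activity travels backwards: before the recolouring, a colour takes the part of the colour it
    becomes. *)
Lemma decomposed_recolour k (T : finType) (G : sgraph T) (c c' : T -> 'I_k)
    (phi : 'I_k -> 'I_k) (U : finType) (h : T -> U) f :
  (forall x, c x = phi (c' x)) ->
  decomposed G c' h (f \o phi) -> decomposed G c h f.
Proof. by move=> def_c; have -> : c = phi \o c' by exact/funext. Qed.

(** * Joins *)

Section Join.
Variables (k : nat) (T : finType) (G G' : sgraph T).
Variables (c : T -> 'I_k) (i j : 'I_k).
Hypotheses (G'G : forall x y, G' x y -> G x y)
  (GE : forall x y, G x y ->
    [|| G' x y, (c x == i) && (c y == j) | (c x == j) && (c y == i)])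
  (ijG : forall x y, c x = i -> c y = j -> G x y)
  (i_used : exists x, c x = i) (j_used : exists x, c x = j).
Variables (U : finType) (h : T -> U) (f : 'I_k -> {set U}).

(** The activity just below the join: an inactive class among [i], [j] becomes a maximal active
    class, hence a part. *)
Definition activate (l : 'I_k) : {set U} :=
  if (f l == set0) && (l \in [set i; j])
  then h @: [set x | c x == l] else f l.

Lemma activate_id l : f l != set0 -> activate l = f l.
Proof. by rewrite /activate => /negPf->. Qed.

Lemma activate0 l : activate l = set0 -> f l = set0.
Proof. by have [//|fl] := eqVneq (f l) set0; rewrite activate_id. Qed.

Lemma activate_new l : l \in [set i; j] -> activate l != set0.
Proof.
rewrite /activate => lij; rewrite lij andbT.
case: (eqVneq (f l)) => // _.
have [x cx] : exists x, c x = l by case/set2P: lij => ->.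
by apply/set0Pn; exists (h x); apply: imset_f; rewrite inE cx.
Qed.

Hypothesis h_inj : injective h.

Lemma compatible_activate : compatible c h f -> compatible c h activate.
Proof.
move=> cf x l; rewrite {1 2}/activate; case: ifP => [/andP[fl lij]|_ xl].
  case/imsetP => y; rewrite inE => /eqP cy /h_inj ->.
  by rewrite /activate cy fl lij.
have fl := cf _ _ xl; rewrite fl in xl *.
by rewrite activate_id //; apply/set0Pn; exists (h x).
Qed.

(** The same parts, tree and bags serve for [G]. *)
Lemma decomposed_join : decomposed G' c h activate -> decomposed G c h f.
Proof.
case=> p [R [B [act inact inB cardB edgeB]]]; exists p, R, B; split=> //.
- by move=> x fx; have := act x; rewrite activate_id //; apply.
- move=> x fx.
  (* Either the part is inherited as inactive from [G'], or this join activates it and it is a whole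
     colour class. *)
  have [/inact[hx topx px [v dom]]|ax] := eqVneq (activate (c x)) set0.
    split=> // [u /px[y [-> /activate0 cy py]]|]; first by exists y.
    exists v => y /dom; rewrite !inE => /orP[->//|/G'G->]; exact: orbT.
  have [px topx] := act x ax.
  have cxij : c x \in [set i; j].
    by apply: contraNT ax => /negPf e; rewrite /activate e andbF fx.
  have pxE : p x = h @: [set y | c y == c x].
    by rewrite px /activate fx eqxx cxij.
  split; first by rewrite pxE imset_f ?inE.
  + by exists (root R).
  + move=> u; rewrite pxE => /imsetP[y]; rewrite inE => /eqP cy ->; exists y.
    rewrite cy; split=> //; rewrite -pxE px.
    by have := act y; rewrite cy => /(_ ax)[].
  (* Any vertex of the other joined colour dominates the class. *)
  + have [v vG] : exists v, forall y, c y = c x -> G v y.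
      case/set2P: cxij => ->.
        by have [v cv] := j_used; exists v => y cy; rewrite adj_sym ijG.
      by have [v cv] := i_used; exists v => y cy; rewrite ijG.
    exists v => y; rewrite pxE => /imsetP[z]; rewrite inE => /eqP cz /h_inj ->.
    by rewrite inE vG ?orbT.
(* Both joined colours are active in [G'], so the root bag covers every new edge. *)
- have in_root x : c x \in [set i; j] -> p x \in B (root R).
    by move=> /activate_new/act[_ []].
  move=> x y /GE/or3P[/edgeB//|/andP[/eqP cx /eqP cy]|/andP[/eqP cx /eqP cy]];
    by exists (root R); rewrite !in_root // ?cx ?cy !inE eqxx ?orbT.
Qed.

End Join.

(** * Disjoint unions *)

Section Union.
Variables (k : nat) (T : finType) (G : sgraph T) (c : T -> 'I_k).
Variables (U : finType) (h : T -> U) (f : 'I_k -> {set U}).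
Hypothesis h_inj : injective h.
Hypothesis comp_f : compatible c h f.

Lemma decomposed_union (A : {set T}) :
  (forall x y, x \in A -> y \in ~: A -> ~~ G x y) ->
  decomposed (induced G A) (fun x => c (val x)) (h \o val) f ->
  decomposed (induced G (~: A)) (fun x => c (val x)) (h \o val) f ->
  decomposed G c h f.
Proof.
move=> noG [p1 [R1 [B1 [act1 inact1 inB1 cardB1 edgeB1]]]].
move=> [p2 [R2 [B2 [act2 inact2 inB2 cardB2 edgeB2]]]].
pose p x := if insub x : option {x | x \in A} is Some y then p1 y else
            if insub x : option {x | x \in ~: A} is Some y then p2 y else set0.
have pE1 y : p (val y) = p1 y by rewrite /p valK.
have pE2 y : p (val y) = p2 y.
  by rewrite /p insubN ?valK //; have := valP y; rewrite inE.
(* The bag of the new root: the active parts, at most one per colour. *)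
pose C := f @: [set i in codom c | f i != set0].
have compat_ne x y : f (c x) = set0 -> h x \in f (c y) -> f (c y) = set0.
  by move=> fx /comp_f->.
have inC S : S \in C -> exists2 x, S = f (c x) & f (c x) != set0.
  by case/imsetP=> i; rewrite inE => /andP[/codomP[x ->] fx] ->; exists x.
have memC x : f (c x) != set0 -> f (c x) \in C.
  by move=> fx; apply: imset_f; rewrite inE codom_f.
have split_x x : (exists y : {x | x \in A}, x = val y)
              \/ (exists y : {x | x \in ~: A}, x = val y).
  have [xA|xA] := boolP (x \in A); first by left; exists (Sub x xA).
  by rewrite -in_setC in xA; right; exists (Sub x xA).
have actp x : f (c x) != set0 -> p x = f (c x).
  by case: (split_x x) => -[y ->] fy;
    [rewrite pE1; case: (act1 y) | rewrite pE2; case: (act2 y)].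
have inact_notC x : f (c x) = set0 -> h x \in p x -> p x \notin C.
  move=> fx hx; apply/negP=> /inC[y pxE /eqP fy].
  by apply: fy; apply: (compat_ne x); rewrite -?pxE.
exists p, (graft R1 R2), (graft_bag C B1 B2); split.
- move=> x fx; rewrite actp //; split=> //; apply: top_node_graft_root.
  + exact: memC.
  (* If [y] were inactive, its image would lie in an active part, against compatibility; so the part
     reaches the root of [R1]. *)
  + move=> m /inB1[y Sy]; have [fy|fy] := eqVneq (f (c (val y))) set0.
      have [hy _ _ _] := inact1 y fy; rewrite -Sy in hy.
      by rewrite (compat_ne _ _ fy hy) eqxx in fx.
    by rewrite Sy; have [] := act1 y fy.
  + move=> m /inB2[y Sy]; have [fy|fy] := eqVneq (f (c (val y))) set0.
      have [hy _ _ _] := inact2 y fy; rewrite -Sy in hy.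
      by rewrite (compat_ne _ _ fy hy) eqxx in fx.
    by rewrite Sy; have [] := act2 y fy.
- move=> x; case: (split_x x) => -[y ->] fy.
    have [hy [t topt] py [v dom]] := inact1 y fy; have notC := inact_notC _ fy.
    rewrite pE1 in notC *; split=> //.
    + exists (Some (inl t)); apply: top_node_graftl => //; first exact: notC.
      (* An inactive part of the left side consists of images of vertices of [A], so it cannot be
         the part of a vertex [z] of the right side. *)
      move=> m; apply/negP=> /inB2[z Sz].
      have [fz|fz] := eqVneq (f (c (val z))) set0.
        have [hz _ _ _] := inact2 z fz; rewrite -Sz in hz.
        have [w [/h_inj zw _ _]] := py _ hz.
        by have := valP z; rewrite zw inE (valP w).
      have [pz _] := act2 z fz; rewrite Sz pz in hy.
      by rewrite (compat_ne _ _ fy hy) eqxx in fz.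
    + move=> u /py[z [-> fz pz]]; exists (val z); split=> //.
      by rewrite pE1.
    + exists (val v) => z hz; have [w [/h_inj zw _ _]] := py _ hz.
      by rewrite zw in hz *; have := dom w hz; rewrite !inE.
  have [hy [t topt] py [v dom]] := inact2 y fy; have notC := inact_notC _ fy.
  rewrite pE2 in notC *; split=> //.
  + exists (Some (inr t)); apply: top_node_graftr => //; first exact: notC.
    move=> m; apply/negP=> /inB1[z Sz].
    have [fz|fz] := eqVneq (f (c (val z))) set0.
      have [hz _ _ _] := inact1 z fz; rewrite -Sz in hz.
      have [w [/h_inj zw _ _]] := py _ hz.
      by have := valP w; rewrite -zw inE (valP z).
    have [pz _] := act1 z fz; rewrite Sz pz in hy.
    by rewrite (compat_ne _ _ fy hy) eqxx in fz.
  + move=> u /py[z [-> fz pz]]; exists (val z); split=> //.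
    by rewrite pE2.
  + exists (val v) => z hz; have [w [/h_inj zw _ _]] := py _ hz.
    by rewrite zw in hz *; have := dom w hz; rewrite !inE.
- move=> [[m|m]|] S /=.
  + by move=> /inB1[y ->]; exists (val y).
  + by move=> /inB2[y ->]; exists (val y).
  + by move=> /inC[x -> fx]; exists x; rewrite actp.
- move=> [[m|m]|] //=; apply: leq_trans (leq_imset_card _ _) _.
  by rewrite -[leqRHS]card_ord max_card.
- move=> x y; case: (split_x x) => -[x' ->]; case: (split_x y) => -[y' ->] xy.
  + by have [n pn] := edgeB1 x' y' xy; exists (Some (inl n)); rewrite !pE1.
  + by have /negP := noG _ _ (valP x') (valP y').
  + by have /negP := noG _ _ (valP y') (valP x'); rewrite adj_sym.
  + by have [n pn] := edgeB2 x' y' xy; exists (Some (inr n)); rewrite !pE2.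
Qed.

End Union.

(** * The induction and the quotient *)

Lemma cw_pair_decomposed k (T : finType) (G : sgraph T) (c : T -> 'I_k) :
  cw_pair G c ->
  forall (U : finType) (h : T -> U) f,
    injective h -> compatible c h f -> decomposed G c h f.
Proof.
elim=> {T G c}.
- by move=> T G c T1 U h f _ _; apply: decomposed_small.
- move=> T G c A _ _ noG _ IH1 _ IH2 U h f h_inj cf.
  have comp_inj B : injective (h \o (val : {x | x \in B} -> T)).
    exact: inj_comp h_inj val_inj.
  apply: (decomposed_union h_inj cf noG); [apply: IH1|apply: IH2];
    by [apply: comp_inj | move=> x i; apply: cf].
- move=> T G c c' i j _ _ _ _ IH def_c U h f h_inj cf.
  apply: (decomposed_recolour (phi := fun l => if l == i then j else l)
    def_c).
  by apply: IH => // x l /=; rewrite -def_c; apply: cf.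
- move=> T G G' c i j _ [x [y /andP[xy nxy]]] GE _ IH U h f h_inj cf.
  (* The edge added by the join shows that both colours are used, which supplies the dominating
     vertices. *)
  have [[z cz] [w cw]] : (exists z, c z = i) /\ (exists w, c w = j).
    by move: xy; rewrite GE (negPf nxy) /= => /orP[] /andP[/eqP cx /eqP cy];
      split; by [exists x | exists y].
  apply: (decomposed_join (G' := G') (i := i) (j := j)) => //.
  + by move=> a b; rewrite GE => ->.
  + by move=> a b; rewrite GE.
  + by move=> a b ca cb; rewrite GE ca cb !eqxx orbT.
  + by exists z.
  + by exists w.
  + by apply: IH => //; apply: compatible_activate.
Qed.

Lemma has_cw_pair_quotient k (T : finType) (G : sgraph T) :
  has_cw_pair G k ->
  exists P, dominated_partition G P /\
    exists2 n, n <= k & has_tree_decomposition_max_bag (quotient G P) n.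
Proof.
case=> c cwG.
(* Nothing follows the whole construction, so no colour is active and every part is settled and
   dominated. *)
have [|p [R [B [_ inact inB cardB edgeB]]]] :=
    cw_pair_decomposed cwG (h := id) (f := fun=> set0) (@inj_id T).
  by move=> x i; rewrite inE.
have xp x : x \in p x by have [] := inact x erefl.
have p_eq x y : y \in p x -> p y = p x.
  by have [_ _ px _] := inact x erefl; case/px=> z [-> _].
pose P := p @: T.
exists P; split.
  rewrite /dominated_partition /partition -!andbA; apply/and4P; split.
  - apply/eqP/setP=> x; rewrite inE; apply/bigcupP.
    by exists (p x); rewrite ?imset_f.
  - apply/trivIsetP => _ _ /imsetP[x _ ->] /imsetP[y _ ->].
    apply: contraR => /pred0Pn[z /andP[/= zx zy]].
    by rewrite -(p_eq _ _ zx) (p_eq _ _ zy).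
  - by apply/imsetP=> -[x _ p0]; have := xp x; rewrite -p0 inE.
  - apply/forall_inP=> _ /imsetP[x _ ->]; have [_ _ _ [v dom]] := inact x erefl.
    by apply/existsP; exists v; apply/subsetP.
pose Q (n : R) : {set {A | A \in P}} := [set A | val A \in B n].
exists (\max_n #|Q n|).
  apply/bigmax_leqP=> n _; apply: leq_trans (cardB n).
  rewrite -(card_imset _ val_inj); apply: subset_leq_card.
  by apply/subsetP=> _ /imsetP[A + ->]; rewrite inE.
exists R, (parent_graph R), Q; split=> //.
have top (A : {A | A \in P}) : exists t, top_node B (val A) t.
  by have /imsetP[x _ ->] := valP A; have [_ ? _ _] := inact x erefl.
split.
- exact: parent_graph_tree.
- by move=> A; have [t [At _]] := top A; exists t; rewrite inE.
- move=> A1 A2 /andP[_ /exists_inP[x xA /exists_inP[y yA xy]]].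
  have pA (A : {A | A \in P}) z : z \in val A -> p z = val A.
    by have /imsetP[w _ ->] := valP A; apply: p_eq.
  have [n pn] := edgeB _ _ xy; exists n.
  by rewrite !inE -(pA A1 x xA) -(pA A2 y yA).
- move=> A; have [t [At up]] := top A.
  apply: (@connected_below _ _ t); first by rewrite !inE.
  by move=> n; rewrite !inE => /up nt /nt.
Qed.

Theorem theorem3 (k : nat) (k_ge1 : 1 <= k) (T : finType) (G : sgraph T)
    (cwG : cliquewidth G <= k) :
  exists P : {set {set T}},
    dominated_partition G P /\ (treewidth (quotient G P) <= k%:Z - 1)%R.
Proof.
have : has_cw_pair G (cliquewidth G).
  by rewrite /cliquewidth; case: ex_minnP => m /asboolP.
case/has_cw_pair_quotient=> P [domP [n le_n tdP]]; exists P; split=> //.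
(* Cancelling the two [- 1] leaves a bound on the least maximal bag size. *)
rewrite /treewidth Num.Theory.lerD2r lez_nat.
case: ex_minnP => m _ /(_ n (introT (asboolP _) tdP)) le_mn.
exact: leq_trans le_mn (leq_trans le_n cwG).
Qed.
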